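(* Let $X$ be a topological space. If $X$ is $Ps$-normal, then $X$ is $CC$-normal.
   Context: A topological space is normal if any two disjoint closed subsets are contained in disjoint open sets (no $T_1$ assumption). A topological space is pseudocompact if every real-valued continuous function on it is bounded; a subset is called pseudocompact if it is pseudocompact in the subspace topology. No separation axiom is assumed in pseudocompactness or countable compactness. A space $X$ is $Ps$-normal (resp. $CC$-normal) if there exist a normal space $Y$ and a bijection $f:X\to Y$ such that $f|_K:K\to f(K)$ is a homeomorphism (subspace topologies) for every pseudocompact (resp. countably compact) subset $K$ of $X$. *)

(* Defs.v *)
From mathcomp Require Import all_boot all_order all_algebra.
From mathcomp Require Import all_classical all_reals all_analysis.
Import numFieldNormedType.Exports.

Set Implicit Arguments.
Unset Strict Implicit.
Unset Printing Implicit Defensive.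

Local Open Scope classical_set_scope.
Local Open Scope ring_scope.

Definition pseudocompact_space (R : realType) (T : topologicalType) : Prop :=
  forall f : T -> R, continuous f -> bounded_fun f.

(* The library's [cover_compact] at the whole space, restricted to countable
   families of open sets. *)
Definition countably_compact_space (T : topologicalType) : Prop :=
  forall (I : choiceType) (D : set I) (f : I -> set T),
    countable D -> (forall i, D i -> open (f i)) ->
    [set: T] `<=` cover D f -> finite_subset_cover D f [set: T].

(* A set [K] used as a type is [set_type K], which carries the subspace
   topology (the initial topology of the inclusion). *)
Definition pseudocompact (R : realType) (X : topologicalType) (K : set X) :
  Prop := pseudocompact_space R K.

Definition countably_compact (X : topologicalType) (K : set X) : Prop :=
  countably_compact_space K.

Definition homeomorphism (S T : topologicalType) (f : S -> T) : Prop :=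
  continuous f /\
  exists g : T -> S, [/\ cancel f g, cancel g f & continuous g].

Definition restr_image (X Y : topologicalType) (f : X -> Y) (K : set X) :
  K -> f @` K := sigLR [fun f in K].

(* [normal_space] assumes no separation axiom; [normal_openP] relates it to the
   separation of disjoint closed sets by disjoint open sets. *)
Definition Ps_normal (R : realType) (X : topologicalType) : Prop :=
  exists (Y : topologicalType) (f : X -> Y),
    [/\ normal_space Y, bijective f &
        forall K : set X, pseudocompact R K ->
          homeomorphism (@restr_image X Y f K)].

Definition CC_normal (X : topologicalType) : Prop :=
  exists (Y : topologicalType) (f : X -> Y),
    [/\ normal_space Y, bijective f &
        forall K : set X, countably_compact K ->
          homeomorphism (@restr_image X Y f K)].

(* Main.v *)
Require Import Defs.
From mathcomp Require Import all_boot all_order all_algebra.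
From mathcomp Require Import all_classical all_reals all_analysis.
Import Order.TTheory GRing.Theory Num.Theory.
Import numFieldNormedType.Exports.

Local Open Scope classical_set_scope.
Local Open Scope ring_scope.

(** Every countably compact subset is pseudocompact, so [CC_normal] tests the restrictions of [f] on
    no more sets than [Ps_normal] does, and the same [Y] and [f] witness it. *)

(* A continuous [f] is bounded as soon as finitely many of the open sets
   [|f| < n] cover the space. *)
Lemma countably_compact_space_pseudocompact (R : realType)
    (T : topologicalType) :
  countably_compact_space T -> pseudocompact_space R T.
Proof.
move=> ccT f cf.
pose U (n : nat) : set T := [set x | `|f x| < n%:R].
have oU n : open (U n).
  apply: (@open_comp _ _ (fun x => `|f x|) [set y : R | y < n%:R]).
    by move=> x _; apply: continuous_comp; [exact: cf | exact: norm_continuous].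
  exact: open_lt.
have cU : [set: T] `<=` cover setT U.
  by move=> x _; exists (Num.bound `|f x|) => //; exact: archi_boundP.
have [D _ DU] := ccT _ _ U (countableP _) (fun i _ => oU i) cU.
(* The [U n] increase with [n], so the largest index in the finite subcover [D] bounds [|f|]. If [D]
   is empty, the maximum is 0 and [T] has no points. *)
exists (\max_(n <- finmap.enum_fset D) n)%:R; split; first exact: realn.
move=> M ltM x _; have [n nD fxn] := DU x I.
apply: ltW; apply: (lt_trans (lt_le_trans fxn _) ltM).
by rewrite ler_nat; exact: leq_bigmax_seq.
Qed.

Theorem theorem2p1 (R : realType) (X : topologicalType) :
  Ps_normal R X -> CC_normal X.
Proof.
move=> [Y [f [nY bf hf]]]; exists Y, f; split=> // K ccK.
by apply: hf; exact: countably_compact_space_pseudocompact.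
Qed.
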